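(* Let $c_0>0$. There is a constant $C>0$ depending only on $c_0$ such that the following holds. Let $E \subset B(0,1)$ be a compact set, and let $\omega,\omega' \in S^1$ satisfy $\angle(\omega,\omega') \ge c_0$ and $\angle(\omega,-\omega') \ge c_0$. Suppose $0 < r_N < r_{N-1} < \dots < r_1 \le 1$ are scales such that each $r_n$ is a negative power of two (in particular $r_{n+1} \le \frac12 r_n$ for $1\le n<N$), and such that, with $E_\omega := \{x\cdot\omega : x \in E\}$ and $E_{\omega'} := \{x\cdot\omega' : x \in E\}$, $$m(\mathcal{N}_{r_{n+1}}(E_\omega)) \le r_n \quad\text{and}\quad m(\mathcal{N}_{r_{n+1}}(E_{\omega'})) \le r_n$$ for all $1 \le n < N$. Then $R_E(r_N, 1, N^{1/100}) \le C N^{-1/100}$.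
   Context: $B(0,1)$ is the open unit ball of $\mathbb{R}^2$, $m$ is Lebesgue measure on $\mathbb{R}$, $\angle(\omega,\omega')\in[0,\pi]$ is the angle between unit vectors, and $\mathcal{N}_r(A)$ is the open $r$-neighbourhood of $A \subset \mathbb{R}$. For $\varepsilon, r, M > 0$ the rectifiability constant is $$R_E(\varepsilon,r,M) = \sup \frac{m(\{x \in J : x\omega_1 + (F(x)+y)\omega_2 \in E \text{ for some } -\varepsilon \le y \le \varepsilon\})}{m(J)},$$ the supremum over all orthonormal $\omega_1,\omega_2 \in S^1$, all $F:\mathbb{R}\to\mathbb{R}$ with Lipschitz constant at most $M$, and all intervals $J \subset \mathbb{R}$ of length at least $r$. *)

(* Defs.v *)
From HB Require Import structures.
From mathcomp Require Import all_boot all_order all_algebra.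
From mathcomp Require Import all_classical all_reals all_analysis.
Set Implicit Arguments. Unset Strict Implicit. Unset Printing Implicit Defensive.
Import Order.TTheory GRing.Theory Num.Theory.
Import numFieldNormedType.Exports.
Local Open Scope classical_set_scope.
Local Open Scope ring_scope.

Section Defs.
Variable R : realType.

Definition dot2 (x y : R * R) : R := x.1 * y.1 + x.2 * y.2.
Definition unit_vec (w : R * R) : Prop := dot2 w w = 1.
Definition angle (w w' : R * R) : R := acos (dot2 w w').
Definition opp2 (w : R * R) : R * R := (- w.1, - w.2).
Definition unit_ball : set (R * R) := [set x | dot2 x x < 1].
Definition proj_set (E : set (R * R)) (w : R * R) : set R := (fun x => dot2 x w) @` E.
Definition nbhd_set (r : R) (A : set R) : set R :=
  [set t | exists2 a, A a & `|t - a| < r].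
Definition lipschitz_le (M : R) (F : R -> R) : Prop :=
  forall x y, `|F x - F y| <= M * `|x - y|.
Definition hit_set (E : set (R * R)) (w1 w2 : R * R) (F : R -> R) (eps a b : R)
  : set R :=
  [set x | a <= x <= b /\ exists y, -eps <= y <= eps /\
     E (x * w1.1 + (F x + y) * w2.1, x * w1.2 + (F x + y) * w2.2)].
Definition rect_const (E : set (R * R)) (eps r M : R) : \bar R :=
  ereal_sup [set z : \bar R | exists w1 w2 F a b,
    unit_vec w1 /\ unit_vec w2 /\ dot2 w1 w2 = 0 /\ lipschitz_le M F /\
    r <= b - a /\
    z = (@lebesgue_measure R (hit_set E w1 w2 F eps a b) * ((b - a)^-1)%:E)%E].
End Defs.

(* Main.v *)
Require Import Defs.
From HB Require Import structures.
From mathcomp Require Import all_boot all_order all_algebra.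
From mathcomp Require Import all_classical all_reals all_analysis.
From mathcomp Require Import measurable_realfun.
From mathcomp Require Import ring lra zify.
Import Order.TTheory GRing.Theory Num.Theory.
Import numFieldNormedType.Exports.
Local Open Scope classical_set_scope.
Local Open Scope ring_scope.

(** Let [f] and [g] be the projections of the Lipschitz curve
    [x w1 + F(x) w2] to [w] and [w'], and let [H] be the hit set, which lies in
    [-1, 1]. On a dyadic interval [I] a little longer than [r_n], compare the
    slope of [f] on [I] with its slopes on dyadic intervals a little shorter
    than [r_(n+1)]. If these all agreed with a common value [s], then
    [|s| m(H /\ I)] would be at most the measure [r_n] of the
    [r_(n+1)]-neighbourhood of the projection of [E], hence much less than
    [|I|]; in general the error is the L^1 norm of the slope difference. By
    transversality the slopes of [f] and [g] on [I] are not both small, so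
    [m(H)] is small as soon as both slope differences are. The slopes form a
    dyadic martingale bounded in L^2, so over well-separated scales the squared
    L^2 norms of these differences have bounded sum, and averaging over the
    scales gives the bound. *)

Lemma sum_blocks (V : nmodType) (n m : nat) (F : nat -> V) :
  \sum_(l < n * m) F l = \sum_(i < n) \sum_(j < m) F (i * m + j)%N.
Proof.
elim: n => [|n IHn]; first by rewrite mul0n !big_ord0.
by rewrite mulSnr big_split_ord big_ord_recr /= IHn.
Qed.

(** * Dyadic cells of [-1, 1], slopes over them and their energy *)

Section Grid.
Context {R : realType}.
Implicit Types (f : R -> R) (k m i j : nat).

Definition mesh k : R := 2 / 2 ^+ k.
Definition grid k i : R := i%:R * mesh k - 1.
Definition slope f k i : R := (f (grid k i.+1) - f (grid k i)) / mesh k.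
(** The squared L^2 norm, for the uniform probability on [-1, 1], of the step function whose value
    on each cell of generation [k] is the slope of [f] there. *)
Definition energy f k : R := 2 ^- k * \sum_(i < 2 ^ k) slope f k i ^+ 2.

Lemma mesh_gt0 k : 0 < mesh k.
Proof. by rewrite divr_gt0// exprn_gt0. Qed.

Lemma gridS k i : grid k i.+1 = grid k i + mesh k.
Proof. by rewrite /grid -natr1; ring. Qed.

Lemma slope_mesh f k i : slope f k i * mesh k = f (grid k i.+1) - f (grid k i).
Proof. by rewrite /slope divfK// gt_eqF// mesh_gt0. Qed.

Lemma meshD k m : 2 ^+ m * mesh (k + m) = mesh k.
Proof. by rewrite /mesh exprD; field; rewrite !expf_neq0. Qed.

Lemma grid_block k m i : grid (k + m) (i * 2 ^ m) = grid k i.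
Proof. by rewrite /grid natrM natrX -mulrA meshD. Qed.

Lemma sum_increments f k m i :
  \sum_(j < 2 ^ m) (f (grid (k + m) (i * 2 ^ m + j).+1)
                    - f (grid (k + m) (i * 2 ^ m + j)))
  = f (grid k i.+1) - f (grid k i).
Proof.
rewrite -(big_mkord xpredT (fun j => f (grid (k + m) (i * 2 ^ m + j).+1)
                    - f (grid (k + m) (i * 2 ^ m + j)))).
under eq_bigr do rewrite -addnS.
by rewrite telescope_sumr// addn0 -mulSnr !grid_block.
Qed.

Lemma sum_slope f k m i :
  \sum_(j < 2 ^ m) slope f (k + m) (i * 2 ^ m + j) = 2 ^+ m * slope f k i.
Proof.
rewrite /slope -mulr_suml sum_increments -(meshD k m).
by field; rewrite gt_eqF ?mesh_gt0// expf_neq0.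
Qed.

(* The slopes form a dyadic martingale, so their increments are orthogonal. *)
Lemma energyB f k m :
  2 ^- (k + m) * (\sum_(i < 2 ^ k) \sum_(j < 2 ^ m)
     (slope f (k + m) (i * 2 ^ m + j) - slope f k i) ^+ 2)
  = energy f (k + m) - energy f k.
Proof.
have block i : \sum_(j < 2 ^ m)
     (slope f (k + m) (i * 2 ^ m + j) - slope f k i) ^+ 2 =
   \sum_(j < 2 ^ m) slope f (k + m) (i * 2 ^ m + j) ^+ 2
   - 2 ^+ m * slope f k i ^+ 2.
  under eq_bigr => j _.
    rewrite (_ : _ ^+ 2 = slope f (k + m) (i * 2 ^ m + j) ^+ 2 +
      (-2 * slope f k i) * slope f (k + m) (i * 2 ^ m + j) + slope f k i ^+ 2).
      over.
    by ring.
  rewrite !big_split /= -mulr_sumr sum_slope sumr_const card_ord.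
  by rewrite -[_ *+ (2 ^ m)]mulr_natl natrX; ring.
rewrite /energy expnD (sum_blocks _ (2 ^ k)%N (2 ^ m)%N (fun l => slope f (k + m) l ^+ 2)).
under eq_bigr do rewrite block.
rewrite sumrB mulrBr -mulr_sumr; congr (_ - _).
by rewrite exprD; field; rewrite !expf_neq0.
Qed.

Lemma energy_le_addn f k m : energy f k <= energy f (k + m).
Proof.
rewrite -subr_ge0 -energyB mulr_ge0 ?invr_ge0 ?exprn_ge0//.
by do 2![apply: sumr_ge0 => ? _]; rewrite sqr_ge0.
Qed.

Lemma energy_mono f : {homo energy f : k m / (k <= m)%N >-> k <= m}.
Proof. by move=> k m /subnKC <-; exact: energy_le_addn. Qed.

Lemma energy_ge0 f k : 0 <= energy f k.
Proof.
rewrite mulr_ge0 ?invr_ge0 ?exprn_ge0//.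
by apply: sumr_ge0 => i _; rewrite sqr_ge0.
Qed.

Lemma energy_lipschitz f (L : R) k :
  (forall x y, `|f x - f y| <= L * `|x - y|) -> energy f k <= L ^+ 2.
Proof.
move=> fL.
have sL i : slope f k i ^+ 2 <= L ^+ 2.
  have : `|slope f k i| <= L.
    rewrite -(ler_pM2r (mesh_gt0 k)) -{1}(gtr0_norm (mesh_gt0 k)) -normrM.
    rewrite slope_mesh (le_trans (fL _ _))// gridS addrC addKr.
    by rewrite gtr0_norm// mesh_gt0.
  by move=> sL; rewrite -(real_normK (num_real (slope f k i))) !expr2 ler_pM.
rewrite /energy ler_pdivrMl ?exprn_gt0//.
rewrite (_ : _ * L ^+ 2 = \sum_(i < 2 ^ k) L ^+ 2).
  by apply: ler_sum => i _; exact: sL.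
by rewrite sumr_const card_ord -[L ^+ 2 *+ _]mulr_natl natrX.
Qed.

(** Write [sigma] as [s j] minus its deviation. Weights in [0, 1] bound the deviations in l^1, while
    the weighted sum of the [s j] is kept whole, so that its cancellations count. *)
Lemma norm_weighted_sum_le (s theta : nat -> R) (m : nat) (sigma mu : R) :
  (forall j, (j < m)%N -> 0 <= theta j <= 1) ->
  `|\sum_(j < m) theta j * s j| <= mu ->
  `|sigma| * \sum_(j < m) theta j <= mu + \sum_(j < m) `|s j - sigma|.
Proof.
move=> th01 hmu.
have th0 : 0 <= \sum_(j < m) theta j.
  by apply: sumr_ge0 => j _; case/andP: (th01 j (ltn_ord j)).
rewrite -{1}(ger0_norm th0) -normrM.
have -> : sigma * (\sum_(j < m) theta j) =
   \sum_(j < m) theta j * s j - \sum_(j < m) theta j * (s j - sigma).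
  by rewrite mulr_sumr -sumrB; apply: eq_bigr => j _; ring.
rewrite (le_trans (ler_normB _ _))// lerD//.
rewrite (le_trans (ler_norm_sum _ _ _))//; apply: ler_sum => j _.
have /andP[t0 t1] := th01 j (ltn_ord j).
by rewrite normrM (ger0_norm t0) ler_piMl.
Qed.

End Grid.

(** * Lebesgue measure on the line and the primitive of an indicator *)

Section Primitive.
Context {R : realType}.
Let mu : set R -> \bar R := @lebesgue_measure R.

(** [mu] is an outer measure on all subsets of the line, so this applies to the hit set as it
    stands. *)
Lemma lebesgue_measure_mono (A B : set R) : A `<=` B -> (mu A <= mu B)%E.
Proof. exact: (le_outer_measure (wlength idfun)^*%mu). Qed.

Lemma lebesgue_measure_cover (n : nat) (A : set R) (B : nat -> set R) :
  A `<=` \big[setU/set0]_(i < n) B i -> (mu A <= \sum_(i < n) mu (B i))%E.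
Proof.
move=> /lebesgue_measure_mono /le_trans; apply.
exact: (outer_measure_subadditive (wlength idfun)^*%mu).
Qed.

Lemma open_nbhd_set (r : R) (A : set R) : open (nbhd_set r A).
Proof.
have -> : nbhd_set r A = \bigcup_(a in A) ball a r.
  apply/seteqP; split=> t [a Aa] /=.
    by move=> h; exists a => //; rewrite /ball/= distrC.
  by move=> h; exists a => //; rewrite distrC; exact: h.
by apply: bigcup_open => a _; exact: ball_open.
Qed.

Lemma measurable_nbhd_set (r : R) (A : set R) :
  measurable (nbhd_set r A : set (measurableTypeR R)).
Proof. by apply: open_measurable; exact: open_nbhd_set. Qed.

(** Take for [Phi x] the measure of the part of [S] up to [x]. As its values stay in [0, c], the
    increments of [Phi \o f] telescope to at most [c] however often [f] runs over [S]. *)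
Lemma distribution_exists (S : set R) (c : R) :
  measurable (S : set (measurableTypeR R)) -> (mu S <= c%:E)%E ->
  exists Phi : R -> R,
  [/\ forall x, 0 <= Phi x <= c,
      forall x y, x <= y -> 0 <= Phi y - Phi x <= y - x &
      forall x y, x <= y -> (forall z, x <= z <= y -> S z) ->
        Phi y - Phi x = y - x].
Proof.
move=> mS Sc.
have half x : measurable (S `&` `]-oo, x] : set (measurableTypeR R)).
  exact: measurableI.
have finS (B : set R) : mu (S `&` B) \is a fin_num.
  rewrite ge0_fin_numE; last first.
    by rewrite -(measure0 (@lebesgue_measure R)) lebesgue_measure_mono.
  apply: (@le_lt_trans _ _ (mu S)); last exact: le_lt_trans (ltry c).
  by apply: lebesgue_measure_mono; exact: subIsetl.
have split x y : x <= y ->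
    (mu (S `&` `]-oo, y]) = mu (S `&` `]-oo, x]) + mu (S `&` `]x, y]))%E.
  move=> xy; rewrite /mu -measureU//.
  - congr lebesgue_measure; rewrite -setIUr; congr setI.
    by rewrite -itv_bndbnd_setU// bnd_simp.
  - exact: measurableI.
  - rewrite setIACA; apply/seteqP; split=> // z /= [_]; rewrite !in_itv/=.
    by move=> [? /andP[]]; lra.
have itv x y : x <= y -> mu `]x, y] = (y - x)%:E.
  rewrite /mu lebesgue_measure_itv/= lte_fin le_eqVlt => /orP[/eqP->|->//].
  by rewrite ltxx subrr.
exists (fun x => fine (mu (S `&` `]-oo, x]))).
have diff x y : x <= y -> fine (mu (S `&` `]-oo, y])) -
   fine (mu (S `&` `]-oo, x])) = fine (mu (S `&` `]x, y])).
  by move=> /split ->; rewrite fineD// addrC addKr.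
split=> [x|x y xy|x y xy xyS].
- rewrite fine_ge0 ?measure_ge0//= -lee_fin fineK// (le_trans _ Sc)//.
  by apply: lebesgue_measure_mono; exact: subIsetl.
- rewrite diff// fine_ge0 ?measure_ge0//= -lee_fin fineK// -itv//.
  by apply: lebesgue_measure_mono; exact: subIsetr.
- rewrite diff// (_ : S `&` _ = `]x, y]%classic) ?itv//.
  apply: setIidr => z /=; rewrite in_itv/= => /andP[xz zy].
  by apply: xyS; rewrite zy ltW.
Qed.

End Primitive.

(** * One projection between a coarse and a fine scale *)

Section OneScale.
Context {R : realType}.
Let mu : set R -> \bar R := @lebesgue_measure R.
Implicit Types (f g : R -> R) (A S H : set R) (hit : nat -> bool).

(* Integrating the indicator of [S] along [f] over a coarse cell gives at most
   [mu S] in absolute value, whatever the multiplicity of [f]. *)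
Lemma slope_hit_le f k m i hit S (c : R) :
  measurable (S : set (measurableTypeR R)) -> (mu S <= c%:E)%E ->
  (forall l z, hit l ->
     f (grid (k + m) l) <= z <= f (grid (k + m) l.+1) \/
     f (grid (k + m) l.+1) <= z <= f (grid (k + m) l) -> S z) ->
  `|slope f k i| *
     (\sum_(j < 2 ^ m) (hit (i * 2 ^ m + j)%N)%:R * mesh (k + m)) <=
  c + \sum_(j < 2 ^ m)
        `|slope f (k + m) (i * 2 ^ m + j) - slope f k i| * mesh (k + m).
Proof.
move=> mS Sc hitS.
have [Phi [Phi0 Phi1 PhiS]] := distribution_exists _ _ mS Sc.
set w := mesh (k + m); have w0 : 0 < w := mesh_gt0 _.
pose p j := f (grid (k + m) (i * 2 ^ m + j)%N).
pose q j := f (grid (k + m) (i * 2 ^ m + j).+1%N).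
(* [theta j] is the mean of the indicator of [S] between [p j] and [q j]. If these coincide, any
   value fits the second clause, and 1 is the one a hit cell asks for. *)
have /boolp.choice[theta theta_spec] : forall j, exists t : R,
    [/\ 0 <= t <= 1, Phi (q j) - Phi (p j) = t * (q j - p j) &
        hit (i * 2 ^ m + j)%N -> t = 1].
  move=> j; have hj := hitS (i * 2 ^ m + j)%N.
  have [pq|qp|pq] := ltgtP (p j) (q j).
  - have := Phi1 _ _ (ltW pq); have d0 : 0 < q j - p j by lra.
    exists ((Phi (q j) - Phi (p j)) / (q j - p j)).
    rewrite divfK ?gt_eqF// divr_ge0 ?ler_pdivrMr//; [split=> //|lra|lra].
      lra.
    move=> h; rewrite PhiS ?divff ?gt_eqF ?ltW// => z ?.
    by apply: (hj z h); left.
  - have := Phi1 _ _ (ltW qp); have d0 : 0 < p j - q j by lra.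
    exists ((Phi (p j) - Phi (q j)) / (p j - q j)).
    rewrite divr_ge0 ?ler_pdivrMr//; [split=> //|lra|lra].
    + lra.
    + by rewrite -[q j - p j]opprB mulrN divfK ?gt_eqF// opprB.
    + move=> h; rewrite PhiS ?divff ?gt_eqF ?ltW// => z ?.
      by apply: (hj z h); right.
  - by exists 1; split; rewrite ?pq ?subrr ?mulr0 ?ler01 ?lexx.
(* Times [w], each term is an increment of [Phi \o f], and the sum telescopes over the coarse
   cell. *)
have tel : `|\sum_(j < 2 ^ m) theta j * slope f (k + m) (i * 2 ^ m + j)|
             <= c / w.
  rewrite ler_pdivlMr// -{1}(gtr0_norm w0) -normrM mulr_suml.
  rewrite (eq_bigr (fun j : 'I_(2 ^ m) =>
      (Phi \o f) (grid (k + m) (i * 2 ^ m + j).+1%N) -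
      (Phi \o f) (grid (k + m) (i * 2 ^ m + j)%N))); last first.
    move=> j _; have [_ /= e _] := theta_spec j.
    by rewrite -mulrA slope_mesh -e.
  rewrite sum_increments ler_norml /=.
  have := Phi0 (f (grid k i.+1)); have := Phi0 (f (grid k i)); lra.
have th01 j : (j < 2 ^ m)%N -> 0 <= theta j <= 1.
  by have [] := theta_spec j.
have := norm_weighted_sum_le (fun j => slope f (k + m) (i * 2 ^ m + j))
  _ _ (slope f k i) _ th01 tel.
rewrite -(ler_pM2r w0) mulrDl divfK ?gt_eqF// mulr_suml; apply: le_trans.
(* Hit cells have weight 1, the others weight at least 0. *)
rewrite -mulrA ler_wpM2l// mulr_suml; apply: ler_sum => j _.
rewrite ler_pM2r//; have [/andP[? _] _ h1] := theta_spec j.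
by case: (hit _) h1 => // ->.
Qed.

Lemma norm_le_amgm (x lambda : R) : 0 < lambda ->
  `|x| <= lambda / 2 + x ^+ 2 / (2 * lambda).
Proof.
move=> l0; rewrite -subr_ge0 -(real_normK (num_real x)).
rewrite (_ : _ - _ = (lambda - `|x|) ^+ 2 / (2 * lambda)).
  by rewrite divr_ge0 ?sqr_ge0// mulr_ge0// ltW.
by field; rewrite gt_eqF.
Qed.

(** [norm_le_amgm] trades the L^1 error for energy, with [lambda] left free. The fine cells have
    total length 2, so the constant terms add up to [lambda], and by [energyB] the squares add up to
    the energy increment over [lambda]. *)
Lemma sum_slope_hit_le f k m hit S (c lambda : R) :
  measurable (S : set (measurableTypeR R)) -> (mu S <= c%:E)%E ->
  (forall l z, hit l ->
     f (grid (k + m) l) <= z <= f (grid (k + m) l.+1) \/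
     f (grid (k + m) l.+1) <= z <= f (grid (k + m) l) -> S z) ->
  0 < lambda ->
  \sum_(i < 2 ^ k) `|slope f k i| *
     (\sum_(j < 2 ^ m) (hit (i * 2 ^ m + j)%N)%:R * mesh (k + m)) <=
  2 ^+ k * c + lambda + (energy f (k + m) - energy f k) / lambda.
Proof.
move=> mS Sc hitS l0.
apply: (@le_trans _ _ (\sum_(i < 2 ^ k) (c + \sum_(j < 2 ^ m)
   (lambda / 2 + (slope f (k + m) (i * 2 ^ m + j) - slope f k i) ^+ 2
      / (2 * lambda)) * mesh (k + m)))).
  apply: ler_sum => i _; apply: (le_trans (slope_hit_le _ _ _ _ _ _ _ mS Sc hitS)).
  rewrite lerD2l; apply: ler_sum => j _.
  by rewrite ler_pM2r ?mesh_gt0// norm_le_amgm.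
rewrite big_split /= sumr_const card_ord -[c *+ _]mulr_natl natrX -addrA lerD2l.
under eq_bigr => i _.
  rewrite -mulr_suml big_split /= sumr_const card_ord -mulr_suml.
  rewrite -[(lambda / 2) *+ _]mulr_natl natrX; over.
rewrite -mulr_suml big_split /= sumr_const card_ord -mulr_suml -energyB.
rewrite -[(_ * (lambda / 2)) *+ _]mulr_natl natrX.
rewrite le_eqVlt; apply/orP; left; apply/eqP.
rewrite /mesh exprD; field.
by rewrite gt_eqF// !expf_neq0.
Qed.

Definition meets H k l : bool :=
  `[< exists2 x, H x & grid k l <= x <= grid k l.+1 >].

Lemma grid0 k : grid k 0 = -1 :> R.
Proof. by rewrite /grid mul0r sub0r. Qed.

Lemma grid_last k : grid k (2 ^ k) = 1 :> R.
Proof. by rewrite /grid /mesh natrX mulrC divfK ?expf_neq0//; ring. Qed.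

Lemma measure_le_meets H k : H `<=` [set x | -1 <= x <= 1] ->
  (mu H <= (\sum_(l < 2 ^ k) (meets H k l)%:R * mesh k)%:E)%E.
Proof.
move=> H1; pose B l : set R :=
  if meets H k l then `[grid k l, grid k l.+1]%classic else set0.
have HB : H `<=` \big[setU/set0]_(l < 2 ^ k) B l.
  move=> x Hx.
  suff [l lk lx] : exists2 l, (l < 2 ^ k)%N & grid k l <= x <= grid k l.+1.
    rewrite -bigcup_mkord; exists l => //; rewrite /B /meets.
    case: asboolP => [_|[]]; first by rewrite /= in_itv.
    by exists x.
  have : grid k 0 <= x <= grid k (2 ^ k) by rewrite grid0 grid_last; exact: H1.
  rewrite -(prednK (expn_gt0 2 k)); elim: (2 ^ k).-1 => [|n IHn].
    by move=> ?; exists 0%N.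
  move=> /andP[x0 xn]; have [xn'|xn'] := leP x (grid k n.+1).
    have [|l ln lx] := IHn; first by rewrite x0.
    by exists l => //; exact: leqW.
  by exists n.+1 => //; rewrite xn ltW.
apply: (le_trans (lebesgue_measure_cover _ _ _ HB)).
rewrite -sumEFin; apply: lee_sum => l _; rewrite /B; case: meets.
  rewrite lebesgue_measure_itv/= lte_fin mul1r gridS; case: ifP => _.
    by rewrite -EFinB lee_fin addrC addKr.
  by rewrite lee_fin ltW// mesh_gt0.
by rewrite mul0r measure0.
Qed.

End OneScale.

(** * Both projections together, summation over scales, and transversality *)

Section Combine.
Context {R : realType}.
Let mu : set R -> \bar R := @lebesgue_measure R.
Implicit Types (f g : R -> R) (A B H : set R).

(** [f] varies by at most [L * mesh k] from a point of [H] to the ends of its cell, so both end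
    values are within [rho] of one [a] in [A], and so is everything between them. *)
Lemma meets_nbhd f A H (eps rho L : R) k :
  lipschitz_le L f ->
  (forall x, H x -> exists2 a, A a & `|f x - a| <= eps) ->
  0 <= L -> eps + L * mesh k < rho ->
  forall l z, meets H k l ->
     f (grid k l) <= z <= f (grid k l.+1) \/
     f (grid k l.+1) <= z <= f (grid k l) -> nbhd_set rho A z.
Proof.
move=> fL nearA L0 small l z /asboolP[x Hx xl] zl.
have [a Aa fxa] := nearA _ Hx; exists a => //.
have close p : `|p - x| <= mesh k -> `|f p - a| < rho.
  move=> px; rewrite (le_lt_trans _ small)//.
  rewrite (_ : f p - a = (f x - a) + (f p - f x)); last by ring.
  rewrite (le_trans (ler_normD _ _))// lerD//.
  by rewrite (le_trans (fL _ _))// ler_wpM2l.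
move: xl; rewrite gridS => xl.
have := close (grid k l); have := close (grid k l.+1).
rewrite gridS !ler_norml !ltr_norml; move: zl; rewrite gridS.
have := @mesh_gt0 R k; move=> m0 zl h1 h2.
have /andP[? ?] := h1 ltac:(lra); have /andP[? ?] := h2 ltac:(lra).
by apply/andP; case: zl => /andP[? ?]; split; lra.
Qed.

(** Adding the bounds for [f] and [g] avoids deciding, cell by cell, which slope is the large one:
    every hit cell carries total weight at least [delta]. *)
Lemma one_scale_bound f g A B H (eps rho L c lambda delta eta : R) k m :
  H `<=` [set x | -1 <= x <= 1] -> mu H = eta%:E ->
  lipschitz_le L f -> lipschitz_le L g ->
  (forall x, H x -> exists2 a, A a & `|f x - a| <= eps) ->
  (forall x, H x -> exists2 a, B a & `|g x - a| <= eps) ->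
  0 <= L -> eps + L * mesh (k + m) < rho ->
  (mu (nbhd_set rho A) <= c%:E)%E -> (mu (nbhd_set rho B) <= c%:E)%E ->
  0 <= delta -> (forall i, delta <= `|slope f k i| + `|slope g k i|) ->
  0 < lambda ->
  delta * eta <= 2 * (2 ^+ k * c + lambda) +
    ((energy f (k + m) - energy f k) + (energy g (k + m) - energy g k)) / lambda.
Proof.
move=> H1 Heta fL gL fA gB L0 small cA cB d0 dfg l0.
have := sum_slope_hit_le f k m (meets H (k + m)) _ _ _
  (measurable_nbhd_set rho A) cA (meets_nbhd _ _ _ _ _ _ _ fL fA L0 small) l0.
have := sum_slope_hit_le g k m (meets H (k + m)) _ _ _
  (measurable_nbhd_set rho B) cB (meets_nbhd _ _ _ _ _ _ _ gL gB L0 small) l0.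
set G := \sum_(i < 2 ^ k) _; set F := \sum_(i < 2 ^ k) _ => hG hF.
suff : delta * eta <= F + G by move/le_trans; apply; rewrite mulrDl; lra.
apply: (@le_trans _ _ (delta * \sum_(l < 2 ^ (k + m))
    (meets H (k + m) l)%:R * mesh (k + m))).
  by rewrite ler_wpM2l// -lee_fin -Heta measure_le_meets.
rewrite expnD (sum_blocks _ (2 ^ k)%N (2 ^ m)%N
  (fun l => (meets H (k + m) l)%:R * mesh (k + m))).
rewrite mulr_sumr /F /G -big_split /=; apply: ler_sum => i _.
rewrite -mulrDl ler_wpM2r// sumr_ge0// => j _.
by rewrite mulr_ge0// ltW// mesh_gt0.
Qed.

(** The ranges from [a j] to [b j] do not overlap, so the increments of a monotone [Q] telescope. *)
Lemma sum_energy_increments_le (Q : nat -> R) (a b : nat -> nat) (T : nat) :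
  {homo Q : k l / (k <= l)%N >-> k <= l} -> (forall k, 0 <= Q k) ->
  (forall j, (j < T)%N -> (b j <= a j.+1)%N) ->
  \sum_(j < T) (Q (b j) - Q (a j)) <= Q (a T).
Proof.
move=> Qm Q0; elim: T => [_|T IHT ba]; first by rewrite big_ord0.
rewrite big_ord_recr /=.
have := IHT (fun j jT => ba j (leqW jT)); have := Qm _ _ (ba T (ltnSn T)); lra.
Qed.

Lemma slope_linear_comb (F : R -> R) (a b : R) k i :
  slope (fun x => x * a + F x * b) k i = a + slope F k i * b.
Proof.
rewrite /slope gridS; field.
by rewrite gt_eqF// mesh_gt0.
Qed.

Lemma dot2_le1 (u v : R * R) : unit_vec u -> unit_vec v -> `|dot2 u v| <= 1.
Proof.
rewrite /unit_vec /dot2 => hu hv; rewrite ler_norml.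
have := sqr_ge0 (u.1 - v.1); have := sqr_ge0 (u.2 - v.2).
have := sqr_ge0 (u.1 + v.1); have := sqr_ge0 (u.2 + v.2).
by rewrite !expr2 => ? ? ? ?; apply/andP; split; nra.
Qed.

(* The Gram determinant of three vectors in the plane vanishes. *)
Lemma sum_sqr_dot2_ge (v w w' : R * R) : unit_vec w -> unit_vec w' ->
  (1 - dot2 w w' ^+ 2) * dot2 v v <= 2 * (dot2 v w ^+ 2 + dot2 v w' ^+ 2).
Proof.
move=> hw hw'.
have gram : (dot2 w w * dot2 w' w' - dot2 w w' ^+ 2) * dot2 v v =
  dot2 v w ^+ 2 * dot2 w' w' + dot2 v w' ^+ 2 * dot2 w w -
  2 * dot2 w w' * (dot2 v w * dot2 v w').
  by rewrite /dot2; ring.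
move: gram; rewrite hw hw' !mulr1 => ->.
have := dot2_le1 _ _ hw hw'; rewrite ler_norml.
set d := dot2 w w'; set a := dot2 v w; set b := dot2 v w' => /andP[? ?].
have := sqr_ge0 (a + b); have := sqr_ge0 (a - b); rewrite !expr2; nra.
Qed.

(** [acos] is decreasing, so the two angle conditions place [dot2 w w'] between [- cos c] and
    [cos c]. *)
Lemma dot2_le_of_angle (w w' : R * R) (c : R) :
  unit_vec w -> unit_vec w' -> 0 <= c <= pi / 2 ->
  c <= angle w w' -> c <= angle w (opp2 w') -> dot2 w w' ^+ 2 <= cos c ^+ 2.
Proof.
move=> hw hw' /andP[c0 cpi].
have d1 : -1 <= dot2 w w' <= 1 by rewrite -ler_norml dot2_le1.
rewrite /angle (_ : dot2 w (opp2 w') = - dot2 w w'); last first.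
  by rewrite /dot2 /=; ring.
have key d : -1 <= d <= 1 -> c <= acos d -> d <= cos c.
  move=> d1' cd; have [/andP[a0 api] acosd] := acos_def d1'.
  rewrite -[d in d <= _]acosd leNgt ltr_cos ?in_itv/= ?a0 ?c0//.
    by rewrite -leNgt.
  by have := pi_ge0 R; lra.
have h1 := key _ d1; have h2 := key (- dot2 w w') ltac:(lra).
move=> /h1 l1 /h2 l2; rewrite -subr_ge0 subr_sqr mulr_ge0//; lra.
Qed.

End Combine.

(** * Choice of scales and the bound on the hit set *)

Section Main.
Context {R : realType}.
Let mu : set R -> \bar R := @lebesgue_measure R.

Lemma hit_set_sub (E : set (R * R)) (w1 w2 : R * R) F (eps a b : R) :
  E `<=` @unit_ball R -> unit_vec w1 -> unit_vec w2 -> dot2 w1 w2 = 0 ->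
  hit_set E w1 w2 F eps a b `<=` [set x | -1 <= x <= 1].
Proof.
move=> E1 u1 u2 o12 x [_ [y [_ /E1]]]; rewrite /unit_ball /=.
set z := F x + y.
rewrite (_ : dot2 _ _ = x ^+ 2 * dot2 w1 w1 + z ^+ 2 * dot2 w2 w2
                        + 2 * x * z * dot2 w1 w2); last first.
  by rewrite /dot2 /=; ring.
rewrite u1 u2 o12 mulr0 addr0 !mulr1 => h.
by move: h (sqr_ge0 z); rewrite !expr2 => h z0; apply/andP; split; nra.
Qed.

(** Strictly increasing integers gain at least 1 at each step. *)
Lemma dyadic_exponents (r : nat -> R) (N : nat) :
  (forall n, (1 <= n <= N)%N -> exists k : nat, r n = 2 ^- k) ->
  (forall n, (1 <= n < N)%N -> r n.+1 < r n) ->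
  exists e : nat -> nat,
    (forall n, (1 <= n <= N)%N -> r n = 2 ^- e n) /\
    forall n m, (1 <= n)%N -> (n + m <= N)%N -> (e n + m <= e (n + m))%N.
Proof.
move=> hr rdec.
have /boolp.choice[e he] : forall n, exists k, (1 <= n <= N)%N -> r n = 2 ^- k.
  move=> n; case: (boolP (1 <= n <= N)%N) => [/hr[k rk]|_]; first by exists k.
  by exists 0%N.
exists e; split=> // n m n1; elim: m => [|m IHm]; first by rewrite !addn0.
rewrite !addnS => nmN; have := IHm (ltnW nmN).
have := rdec (n + m)%N ltac:(lia); rewrite !he; [|lia|lia].
rewrite ltf_pV2 ?posrE ?exprn_gt0// ltr_eXn2l// ?ltr1n//; lia.
Qed.

Lemma sparse_scales (e : nat -> nat) (N D T : nat) :
  (forall n m, (1 <= n)%N -> (n + m <= N)%N -> (e n + m <= e (n + m))%N) ->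
  ((2 * D + 1) * T.+1 + 2 <= N)%N ->
  exists n : nat -> nat, forall j, (j < T)%N ->
    [/\ (1 <= n j)%N && ((n j).+1 < N)%N, (D <= e (n j))%N,
        (e (n j) - D <= e (n j).+1 + D)%N, (e (n j).+1 < e N)%N &
        (e (n j).+1 + D <= e (n j.+1) - D)%N].
Proof.
move=> emono budget; pose P := (2 * D + 1)%N.
exists (fun j => (P * j.+1)%N) => j jT.
have h1 : (P <= P * j.+1)%N by rewrite leq_pmulr.
have h2 : (P * j.+2 <= P * T.+1)%N by rewrite leq_mul2l ltnS jT orbT.
have h3 : (P * j.+2 = P * j.+1 + P)%N by rewrite [LHS]mulnS addnC.
rewrite h3 in h2 *; set n := (P * j.+1)%N in h1 h2 *.
have e1 := emono 1%N n.-1 isT; have e2 := emono n 1%N.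
have e3 := emono n.+1 (P.-1) isT; have e4 := emono n.+1 (N - n.+1)%N isT.
have i1 : (1 + n.-1 = n)%N by rewrite /P in h1; lia.
have i3 : (n.+1 + P.-1 = n + P)%N by rewrite /P; lia.
have i4 : (n.+1 + (N - n.+1) = N)%N by rewrite /P in h1 h2; lia.
rewrite i1 in e1; rewrite i3 in e3; rewrite i4 in e4; rewrite addn1 in e2.
rewrite /P in h1 h2 e3 *; split; [apply/andP; split|..]; lia.
Qed.

Lemma hit_set_measure_le (E : set (R * R)) (w w' w1 w2 : R * R) (N : nat)
    (r : nat -> R) (F : R -> R) (a b kappa c eta : R) :
  E `<=` @unit_ball R -> unit_vec w -> unit_vec w' ->
  0 < c <= pi / 2 -> c <= angle w w' -> c <= angle w (opp2 w') ->
  (forall n, (1 <= n <= N)%N -> exists k : nat, r n = 2 ^- k) ->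
  (forall n, (1 <= n < N)%N -> r n.+1 < r n) ->
  (forall n, (1 <= n < N)%N ->
     (mu (nbhd_set (r n.+1) (proj_set E w)) <= (r n)%:E)%E /\
     (mu (nbhd_set (r n.+1) (proj_set E w')) <= (r n)%:E)%E) ->
  unit_vec w1 -> unit_vec w2 -> dot2 w1 w2 = 0 ->
  2 <= kappa -> kappa ^+ 100 = N%:R -> lipschitz_le kappa F ->
  mu (hit_set E w1 w2 F (r N) a b) = eta%:E ->
  sin c / 2 * eta <= 11 / kappa.
Proof.
move=> E1 uw uw' /andP[c0 cpi] cw cw' hr rdec hproj u1 u2 o12 k2 kN FL Heta.
have k0 : 0 < kappa by lra.
have [e [he emono]] := dyadic_exponents _ _ hr rdec.
(* A margin of [D] dyadic scales on both sides of [r_n, r_(n+1)] makes the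
   coarse cells longer than [r_n] by a factor [8 kappa] and the oscillation of
   [f] and [g] on the fine cells at most [r_(n+1) / 2]. *)
pose D := (Num.trunc (8 * kappa)).+1.
(* The energy increments of [f] and [g] sum to at most [8 * kappa ^+ 2] and enter with a factor
   [kappa]; averaging over more than [kappa ^+ 4] blocks leaves [8 / kappa]. *)
pose T := (Num.trunc (kappa ^+ 4)).+1.
have /andP[D1 D2] : 8 * kappa < D%:R <= 9 * kappa.
  have /andP[t1 t2] : (Num.trunc (8 * kappa))%:R <= 8 * kappa < D%:R.
    by apply: truncn_itv; lra.
  by rewrite t2 /= /D -natr1; lra.
have k4 : 1 <= kappa ^+ 4 by rewrite exprn_ege1//; lra.
have /andP[T1 T2] : kappa ^+ 4 < T%:R <= 2 * kappa ^+ 4.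
  have /andP[t1 t2] : (Num.trunc (kappa ^+ 4))%:R <= kappa ^+ 4 < T%:R.
    by apply: truncn_itv; lra.
  by rewrite t2 /= /T -natr1; lra.
(* The left side is at most [57 * kappa ^+ 5 + 2], while [N] is [kappa ^+ 95 * kappa ^+ 5] with
   first factor at least 128. *)
have budget : ((2 * D + 1) * T.+1 + 2 <= N)%N.
  rewrite -(ler_nat R) -kN natrD natrM natrD natrM -[T.+1%:R]natr1.
  have k95 : 2 ^+ 7 <= kappa ^+ 95.
    apply: (@le_trans _ _ (kappa ^+ 7)); first by rewrite ler_pXn2r// nnegrE; lra.
    by apply: ler_weXn2l => //; lra.
  have -> : kappa ^+ 100 = kappa ^+ 95 * (kappa * kappa ^+ 4).
    by rewrite -exprS -exprD.
  have kk : 1 <= kappa * kappa ^+ 4 by rewrite -exprS exprn_ege1//; lra.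
  have : (2 * D%:R + 1) * (T%:R + 1) <= (19 * kappa) * (3 * kappa ^+ 4).
    by apply: ler_pM; rewrite ?addr_ge0 ?mulr_ge0//; lra.
  have : 2 ^+ 7 * (kappa * kappa ^+ 4) <= kappa ^+ 95 * (kappa * kappa ^+ 4).
    by rewrite ler_wpM2r//; lra.
  rewrite (_ : 2 ^+ 7 = 128%:R); last by rewrite -natrX.
  lra.
have [n nspec] := sparse_scales _ _ _ _ emono budget.
pose A j := (e (n j) - D)%N.
pose B j := (e (n j).+1 + D)%N.
have BA j : (j < T)%N -> (B j <= A j.+1)%N by case/nspec.
pose f x := x * dot2 w1 w + F x * dot2 w2 w.
pose g x := x * dot2 w1 w' + F x * dot2 w2 w'.
have lip v : unit_vec v ->
    lipschitz_le (2 * kappa) (fun x => x * dot2 w1 v + F x * dot2 w2 v).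
  move=> uv x y.
  rewrite (_ : _ - _ = (x - y) * dot2 w1 v + (F x - F y) * dot2 w2 v); last by ring.
  rewrite (le_trans (ler_normD _ _))// !normrM.
  have := dot2_le1 _ _ u1 uv; have := dot2_le1 _ _ u2 uv; have := FL x y.
  have := normr_ge0 (x - y); have := normr_ge0 (F x - F y).
  set X := `|x - y|; set Y := `|F x - F y|; set p := `|dot2 w1 v|.
  set q := `|dot2 w2 v| => Y0 X0 YX q1 p1.
  have : X * p <= X by rewrite ler_piMr.
  have : Y * q <= Y by rewrite ler_piMr.
  have : X <= kappa * X by rewrite ler_peMl//; lra.
  lra.
set H := hit_set _ _ _ _ _ _ _ in Heta.
(* The point of [E] differs from the curve point by [y * w2], where [y] is at most [r N] in absolute
   value. *)
have near v x : unit_vec v -> H x -> exists2 p, proj_set E v p &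
    `|x * dot2 w1 v + F x * dot2 w2 v - p| <= r N.
  move=> uv [_ [y [yr Ey]]].
  exists (dot2 (x * w1.1 + (F x + y) * w2.1, x * w1.2 + (F x + y) * w2.2) v).
    by eexists; [exact: Ey|].
  rewrite (_ : _ - _ = - (y * dot2 w2 v)); last by rewrite /dot2 /=; ring.
  rewrite normrN normrM; have := dot2_le1 _ _ u2 uv.
  by move: yr; rewrite -ler_norml => ? ?; rewrite (le_trans (ler_piMr _ _)).
have s0 : 0 < sin c by apply: sin_gt0_pi; have := pi_gt0 R; lra.
(* The two slopes are the inner products of the chord vector [v = w1 + phi * w2], of length at least
   1, with [w] and [w']. A sum below [sin c / 2] would contradict [sum_sqr_dot2_ge]. *)
have transverse i k : sin c / 2 <= `|slope f k i| + `|slope g k i|.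
  rewrite !slope_linear_comb; set phi := slope F k i.
  pose v : R * R := (w1.1 + phi * w2.1, w1.2 + phi * w2.2).
  have -> : dot2 w1 w + phi * dot2 w2 w = dot2 v w by rewrite /dot2/=; ring.
  have -> : dot2 w1 w' + phi * dot2 w2 w' = dot2 v w' by rewrite /dot2/=; ring.
  have vv : 1 <= dot2 v v.
    have -> : dot2 v v = dot2 w1 w1 + phi ^+ 2 * dot2 w2 w2 + 2 * phi * dot2 w1 w2.
      by rewrite /dot2/=; ring.
    by rewrite u1 u2 o12 mulr0 addr0 mulr1 lerDl sqr_ge0.
  have := sum_sqr_dot2_ge v _ _ uw uw'.
  have := dot2_le_of_angle _ _ _ uw uw' _ cw cw'; rewrite ltW//= => /(_ cpi).
  rewrite cos2sin2 -(real_normK (num_real (dot2 v w))).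
  rewrite -(real_normK (num_real (dot2 v w'))).
  have := normr_ge0 (dot2 v w); have := normr_ge0 (dot2 v w').
  set X := `|_|; set Y := `|_|; set d := dot2 w w' => X0 Y0 dc XY.
  rewrite leNgt; apply/negP => lt.
  have : sin c ^+ 2 <= 2 * (Y ^+ 2 + X ^+ 2).
    apply: le_trans XY; have := sqr_ge0 (sin c) => ?.
    by rewrite -[leLHS]mulr1 ler_pM//; lra.
  by rewrite !expr2; nra.
(* Here [lambda] is [1 / kappa]. Since [2 ^+ A j * r (n j) = 2 ^- D <= 1 / (8 * kappa)], the main
   term is [2 * (1 / 8 + 1) / kappa]. *)
have scale j : (j < T)%N -> sin c / 2 * eta <= 9 / 4 / kappa +
    kappa * ((energy f (B j) - energy f (A j)) + (energy g (B j) - energy g (A j))).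
  move=> jT; have [/andP[n1 n2] De AB eN _] := nspec j jT.
  have njN : (1 <= n j < N)%N by rewrite n1 (ltn_trans (ltnSn _)).
  have [mf mg] := hproj _ njN.
  have pD : 8 * kappa < 2 ^+ D.
    by rewrite (lt_le_trans D1)// -natrX ler_nat ltnW// ltn_expl.
  (* Each summand takes half of [r (n j).+1]: the first because [(n j).+1 < N], the second because
     [4 * kappa * 2 ^- D < 1 / 2]. *)
  have small : r N + 2 * kappa * mesh (A j + (B j - A j)) < r (n j).+1.
    rewrite subnKC// he; last by rewrite leqnn (leq_trans n1)// ltnW//; case/andP: njN.
    rewrite he; last exact: ltnW.
    have : (2 ^- e N : R) <= 2 ^- (e (n j).+1).+1.
      by rewrite lef_pV2 ?posrE ?exprn_gt0// ler_eXn2l ?ltr1n.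
    rewrite /mesh /B exprD exprS !invfM.
    have : 0 < (2 : R) ^- e (n j).+1 by rewrite invr_gt0 exprn_gt0.
    set z := 2 ^- _ => z0 h.
    have : 8 * kappa * 2 ^- D < 1 by rewrite ltr_pdivrMr ?exprn_gt0// mul1r.
    nra.
  have L0 : 0 <= 2 * kappa by lra.
  have d0 : 0 <= sin c / 2 by lra.
  have l0 : 0 < kappa^-1 by rewrite invr_gt0.
  have := one_scale_bound f g _ _ H _ _ _ _ _ _ _ _ _
    (hit_set_sub _ _ _ _ _ _ _ E1 u1 u2 o12) Heta (lip _ uw) (lip _ uw')
    (near w ^~ uw) (near w' ^~ uw') L0 small mf mg d0 (transverse ^~ (A j)) l0.
  rewrite subnKC// invrK he; last by rewrite n1 ltnW//; case/andP: njN.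
  have -> : (2 : R) ^+ A j * 2 ^- e (n j) = 2 ^- D.
    rewrite (_ : e (n j) = (A j + D)%N); last by rewrite subnK.
    by rewrite exprD invfM mulrA divff ?mul1r// expf_neq0.
  have : 2 ^- D <= (8 * kappa)^-1.
    by rewrite lef_pV2 ?posrE ?exprn_gt0// ?mulr_gt0// ltW.
  by rewrite invfM; lra.
have sumE (h : R -> R) :=
  sum_energy_increments_le _ _ _ _ (energy_mono h) (energy_ge0 h) BA.
have : T%:R * (sin c / 2 * eta) <=
    T%:R * (9 / 4 / kappa) + kappa * (8 * kappa ^+ 2).
  have -> : T%:R * (sin c / 2 * eta) = \sum_(j < T) (sin c / 2 * eta).
    by rewrite sumr_const card_ord -[RHS]mulr_natl.
  apply: (@le_trans _ _ (\sum_(j < T) (9 / 4 / kappa + kappa *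
      ((energy f (B j) - energy f (A j)) + (energy g (B j) - energy g (A j)))))).
    by apply: ler_sum => j _; exact: scale.
  rewrite big_split /= sumr_const card_ord -[(9 / 4 / kappa) *+ _]mulr_natl lerD2l.
  rewrite -mulr_sumr big_split /= ler_pM2l//.
  have := energy_lipschitz f _ (A T) (lip _ uw).
  have := energy_lipschitz g _ (A T) (lip _ uw').
  have := sumE f; have := sumE g.
  rewrite (_ : (2 * kappa) ^+ 2 = 4 * kappa ^+ 2); last by ring.
  lra.
have T0 : 0 < T%:R :> R by lra.
move=> bound; rewrite -(ler_pM2l T0); apply: le_trans bound _.
have -> : kappa * (8 * kappa ^+ 2) = 8 * kappa ^+ 4 / kappa.
  by field; rewrite gt_eqF.
(* With [kappa ^+ 4 < T] this is [9 / 4 + 8 <= 11]. *)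
rewrite !mulrA -mulrDl ler_pM2r ?invr_gt0//; lra.
Qed.
End Main.

Theorem theorem1p14 (R : realType) (c0 : R) (hc0 : 0 < c0) :
  exists C : R, 0 < C /\
  forall (E : set (R * R)) (w w' : R * R) (N : nat) (r : nat -> R),
    compact E -> E `<=` @unit_ball R ->
    unit_vec w -> unit_vec w' ->
    c0 <= angle w w' -> c0 <= angle w (opp2 w') ->
    (1 <= N)%N ->
    (forall n, (1 <= n <= N)%N -> exists k : nat, r n = 2 ^- k) ->
    (forall n, (1 <= n < N)%N -> r n.+1 < r n) ->
    (forall n, (1 <= n < N)%N ->
       (@lebesgue_measure R (nbhd_set (r n.+1) (proj_set E w)) <= (r n)%:E)%E /\
       (@lebesgue_measure R (nbhd_set (r n.+1) (proj_set E w')) <= (r n)%:E)%E) ->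
    (rect_const E (r N) 1 (N%:R `^ (100%:R^-1)) <= (C * N%:R `^ (- (100%:R^-1)))%:E)%E.
Proof.
(* Capping the angle at [pi / 2] makes [sin c] positive. *)
pose c := Num.min c0 (pi / 2).
have cc0 : c <= c0 by rewrite ge_min lexx.
have cpi : 0 < c <= pi / 2.
  by rewrite lt_min hc0 divr_gt0 ?pi_gt0// ge_min lexx orbT.
have s0 : 0 < sin c.
  by case/andP: cpi => ? ?; apply: sin_gt0_pi; have := pi_gt0 R; lra.
have s2 : 0 < 22 / sin c by rewrite divr_gt0.
(* The 4 covers [kappa < 2], where [eta <= 2] suffices; the other term is 11 divided by
   [sin c / 2]. *)
exists (4 + 22 / sin c); split; first by lra.
move=> E w w' N r _ E1 uw uw' cw cw' N1 hr rdec hproj.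
rewrite powRN; set kappa := N%:R `^ _.
have k1 : 1 <= kappa.
  by rewrite -(powRr0 N%:R) ler_powR ?ler1n ?invr_ge0.
have k0 : 0 < kappa by lra.
have kN : kappa ^+ 100 = N%:R.
  by rewrite -powR_mulrn ?powR_ge0// -powRrM mulVf ?powRr1.
apply: ge_ereal_sup => _ [w1 [w2 [F [a [b [u1 [u2 [ort [FL [ab ->]]]]]]]]]].
set H := hit_set _ _ _ _ _ _ _.
have H2 : (@lebesgue_measure R H <= 2%:E)%E.
  apply: (@le_trans _ _ (@lebesgue_measure R `[-1, 1])).
    apply: lebesgue_measure_mono => x Hx /=; rewrite in_itv/=.
    exact: (hit_set_sub _ _ _ _ _ _ _ E1 u1 u2 ort _ Hx).
  rewrite lebesgue_measure_itv/= lte_fin; case: ifP => _; rewrite ?lee_fin//; lra.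
have H0 : (0 <= @lebesgue_measure R H)%E.
  by rewrite -(measure0 (@lebesgue_measure R)) lebesgue_measure_mono.
have Hfin : @lebesgue_measure R H \is a fin_num.
  by rewrite ge0_fin_numE//; apply: le_lt_trans H2 (ltry _).
move: H2 H0; rewrite -(fineK Hfin).
set eta := fine _ => H2 H0; rewrite -EFinM lee_fin; rewrite !lee_fin in H2 H0.
(* The interval has length at least 1, so dividing by it only lowers [eta]. *)
apply: (@le_trans _ _ eta).
  by rewrite ler_piMr// invf_le1// (lt_le_trans _ ab).
rewrite ler_pdivlMr//.
have [k2|k2] := leP 2 kappa; last first.
  have : eta * kappa <= 2 * 2 by rewrite ler_pM// ltW.
  by lra.
have := hit_set_measure_le E w w' w1 w2 N r F a b kappa c eta E1 uw uw' cpi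
  (le_trans cc0 cw) (le_trans cc0 cw') hr rdec hproj u1 u2 ort k2 kN FL
  (esym (fineK Hfin)).
rewrite ler_pdivlMr// => h.
have : eta * kappa <= 22 / sin c by rewrite ler_pdivlMr//; lra.
by lra.
Qed.
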